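(* Let $G$ be a connected graph on at least three vertices and let $H$ be a connected graph. If $\operatorname{diam}(G)\le 2$ and $\operatorname{aw}(P_3\square H,3)=3$, then $\operatorname{aw}(G\square H,3)=3$.
   Context: All graphs are finite, simple, undirected and connected. $P_n$ denotes the path graph on $n$ vertices. $\operatorname{d}_G(u,v)$ (or $\operatorname{d}(u,v)$) is the length of a shortest $u$-$v$ path in $G$, and $\operatorname{diam}(G)$ is the maximum distance between pairs of vertices of $G$. The Cartesian product $G\square H$ has vertex set $V(G)\times V(H)$, with $(x,y)$ and $(x',y')$ adjacent iff either $x=x'$ and $yy'\in E(H)$, or $y=y'$ and $xx'\in E(G)$. A $k$-term arithmetic progression ($k$-AP) in $G$ is a set of vertices $\{v_1,\dots,v_k\}$ for which there is a $d$ with $\operatorname{d}(v_i,v_{i+1})=d$ for all $1\le i\le k-1$. An exact $r$-coloring of $G$ is a surjective function $c:V(G)\to\{1,\dots,r\}$. A $k$-AP $\{v_1,\dots,v_k\}$ is rainbow under $c$ if $c(v_i)\ne c(v_j)$ whenever $i\neq j$. The anti-van der Waerden number $\operatorname{aw}(G,k)$ is the least positive integer $r$ such that every exact $r$-coloring of $G$ contains a rainbow $k$-AP (if no coloring of the vertices yields a rainbow $k$-AP, then $\operatorname{aw}(G,k)=|V(G)|+1$). *)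

(* Defs.v *)
From mathcomp Require Import all_boot.

Set Implicit Arguments.
Unset Strict Implicit.
Unset Printing Implicit Defensive.

Record sgraph := SGraph {
  vertex :> finType;
  adj : rel vertex;
  adj_sym : symmetric adj;
  adj_irrefl : irreflexive adj }.

(* The null graph is not connected. *)
Definition connected_graph (G : sgraph) : Prop :=
  0 < #|G| /\ forall x y : G, connect (@adj G) x y.

Definition path_adj (n : nat) : rel 'I_n :=
  fun i j => (j == i.+1 :> nat) || (i == j.+1 :> nat).

Lemma path_adj_sym n : symmetric (@path_adj n).
Proof. by move=> i j; rewrite /path_adj orbC. Qed.

Lemma path_adj_irrefl n : irreflexive (@path_adj n).
Proof. by move=> i; rewrite /path_adj orbb ltn_eqF. Qed.

Definition path_graph (n : nat) : sgraph :=
  SGraph (@path_adj_sym n) (@path_adj_irrefl n).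

Section CartesianProduct.
Variables G H : sgraph.

Definition cart_adj : rel (G * H)%type := fun u v =>
  ((u.1 == v.1) && adj u.2 v.2) || ((u.2 == v.2) && adj u.1 v.1).

Lemma cart_adj_sym : symmetric cart_adj.
Proof.
by move=> u v; rewrite /cart_adj (eq_sym u.1) (eq_sym u.2) !(adj_sym u.1)
  !(adj_sym u.2).
Qed.

Lemma cart_adj_irrefl : irreflexive cart_adj.
Proof. by move=> u; rewrite /cart_adj !adj_irrefl !andbF. Qed.

Definition cart_prod : sgraph := SGraph cart_adj_sym cart_adj_irrefl.

End CartesianProduct.

Section Distance.
Variable G : sgraph.

Definition has_path (x y : G) (n : nat) : bool :=
  [exists p : n.-tuple G,
     [&& path (@adj G) x p, last x p == y & uniq (x :: p)]].

(* A path has fewer than #|G| edges, so this is the least n such that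
   has_path x y n; it is #|G| if x and y lie in different components. *)
Definition dist (x y : G) : nat := find (has_path x y) (iota 0 #|G|).

Definition diam : nat := \max_(x : G) \max_(y : G) dist x y.

Lemma has_path_lt x y n : has_path x y n -> n < #|G|.
Proof.
case/existsP=> p /and3P[_ _ /card_uniqP /= cp].
by rewrite -(size_tuple p) -[(size p).+1]cp max_card.
Qed.

Lemma dist_leq x y n : has_path x y n -> dist x y <= n.
Proof.
move=> hn; rewrite leqNgt; apply/negP=> lt_n.
have := before_find 0 lt_n.
by rewrite nth_iota ?add0n ?hn //; apply: has_path_lt hn.
Qed.

Lemma dist_has_path x y : connect (@adj G) x y -> has_path x y (dist x y).
Proof.
case/connectP=> p e_p ->; case/shortenP: e_p => q e_q u_q _.
have hq : has_path x (last x q) (size q).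
  by apply/existsP; exists (in_tuple q); rewrite e_q u_q eqxx.
have hs : has (has_path x (last x q)) (iota 0 #|G|).
  by apply/hasP; exists (size q); rewrite // mem_iota (has_path_lt hq).
have := nth_find 0 hs; rewrite nth_iota //.
by rewrite has_find size_iota in hs.
Qed.

Lemma dist_diam x y : dist x y <= diam.
Proof.
apply: leq_trans (leq_bigmax_cond (P := xpredT) x isT).
exact: (leq_bigmax_cond (P := xpredT) (F := dist x) y isT).
Qed.

End Distance.

Section AntiVanDerWaerden.
Variables (G : sgraph) (k : nat).

(* A k-AP is handled through an enumeration v of its terms. The common
   difference is a distance in G, hence is at most diam G. *)
Definition is_AP (v : {ffun 'I_k -> G}) : bool :=
  [exists d : 'I_(diam G).+1, forall i : 'I_k, forall j : 'I_k,
     (j == i.+1 :> nat) ==> (dist (v i) (v j) == d)].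

Lemma is_APP (v : {ffun 'I_k -> G}) :
  reflect (exists d, forall i j : 'I_k, j = i.+1 :> nat -> dist (v i) (v j) = d)
          (is_AP v).
Proof.
apply: (iffP existsP) => [[d /forallP dP] | [d dP]].
  by exists d => i j ij; have /forallP/(_ j) := dP i; rewrite ij eqxx => /eqP.
have [lt1k | le_k1] := ltnP 1 k.
  pose i0 := Ordinal (ltnW lt1k); pose i1 := Ordinal lt1k.
  have ltd : d < (diam G).+1 by rewrite ltnS -(dP i0 i1) // dist_diam.
  exists (Ordinal ltd); apply/forallP=> i; apply/forallP=> j.
  by apply/implyP=> /eqP /dP ->.
exists ord0; apply/forallP=> i; apply/forallP=> j; apply/implyP=> /eqP ij.
by have := leq_trans (ltn_ord j) le_k1; rewrite ij.
Qed.

(* Colors are 0, ..., r - 1 instead of 1, ..., r. *)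
Definition exact_coloring (r : nat) (c : {ffun G -> 'I_r}) : bool :=
  [forall a : 'I_r, exists x : G, c x == a].

Definition rainbow (r : nat) (c : {ffun G -> 'I_r}) (v : {ffun 'I_k -> G}) :
  bool := [forall i : 'I_k, forall j : 'I_k, (i != j) ==> (c (v i) != c (v j))].

Definition has_rainbow_AP (r : nat) (c : {ffun G -> 'I_r}) : bool :=
  [exists v : {ffun 'I_k -> G}, is_AP v && rainbow c v].

Definition forces_rainbow_AP (r : nat) : bool :=
  [forall c : {ffun G -> 'I_r}, exact_coloring c ==> has_rainbow_AP c].

Lemma exact_coloring_leq r (c : {ffun G -> 'I_r}) :
  exact_coloring c -> r <= #|G|.
Proof.
move/forallP=> c_onto; rewrite -[r]card_ord.
rewrite -(card_codom (f := fun a => xchoose (existsP (c_onto a)))) ?max_card //.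
move=> a b /= eq_ab; rewrite -(eqP (xchooseP (existsP (c_onto a)))) eq_ab.
exact: eqP (xchooseP (existsP (c_onto b))).
Qed.

Lemma aw_exists : exists r, (0 < r) && forces_rainbow_AP r.
Proof.
exists #|G|.+1; apply/forallP=> c; apply/implyP=> /exact_coloring_leq.
by rewrite ltnn.
Qed.

(* If no coloring yields a rainbow k-AP, this is #|G|.+1: see aw_no_rainbow. *)
Definition aw : nat := ex_minn aw_exists.

Lemma exact_coloring_ex r : 0 < r <= #|G| ->
  exists c : {ffun G -> 'I_r}, exact_coloring c.
Proof.
case: r => // r /= le_rG; exists [ffun x => inord (enum_rank x)].
apply/forallP=> a; apply/existsP.
exists (enum_val (Ordinal (leq_trans (ltn_ord a) le_rG))).
by rewrite ffunE enum_valK /= inord_val.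
Qed.

Lemma aw_no_rainbow :
  (forall r (c : {ffun G -> 'I_r}), exact_coloring c -> ~~ has_rainbow_AP c) ->
  aw = #|G|.+1.
Proof.
move=> noR; rewrite /aw; case: ex_minnP => r /andP[r_gt0 /forallP fr] r_min.
apply/eqP; rewrite eqn_leq; apply/andP; split.
  apply: r_min; apply/forallP=> c; apply/implyP=> /exact_coloring_leq.
  by rewrite ltnn.
rewrite ltnNge; apply/negP=> le_rG.
have [|c exc] := @exact_coloring_ex r; first by rewrite r_gt0.
by have := fr c; rewrite exc /= (negbTE (noR _ _ exc)).
Qed.

End AntiVanDerWaerden.

(* Main.v *)
Require Import Defs.
From mathcomp Require Import all_boot.
From mathcomp Require Import zify.

(** Suppose that a coloring of G [] H uses three colors and has no rainbow
3-AP. A row is a copy of H over one vertex of G, a layer a copy of G over one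
vertex of H; distances in G [] H are sums of distances in the factors.

Three distinct vertices x, y, z of G that induce a connected subgraph induce
either a path with dist x z = 2 or a triangle, and in both cases the rows over
them form an isometric subgraph of G [] H. They show at most two colors. For
the path this is the hypothesis on P_3 [] H, carried over by the isometry
(isometric_rainbow). For the triangle it holds for every connected H
(triangle_product_miss): if all layers are monochromatic, take an edge of H
whose ends differ in color and a vertex g of the third color. The distances
from g to the two ends differ by at most one, and choosing the rows
suitably evens them out. If some layer has two colors, the third color lies in a
single row, for two vertices of the layer off the row of g are equidistant
from g. This confines two of the colors to one row and leaves the other rows
with the remaining color, and then a geodesic of H between vertices of the two
confined colors gives a rainbow 3-AP.

Any two vertices of G lie in such a connected triple, because diam G is at
most 2 and G has at least three vertices; so two rows together miss a color.
Then three rows carrying the three colors are each monochromatic, and inside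
one layer they give three vertices of distinct colors with pairwise distances
1 or 2. Two of these distances agree, which is a rainbow 3-AP. *)

Set Implicit Arguments.
Unset Strict Implicit.
Unset Printing Implicit Defensive.

(** * Distances in graphs and in Cartesian products *)

Section Distance.
Variable G : sgraph.
Implicit Types x y z : G.

Lemma dist_walk x (p : seq G) :
  path (@adj G) x p -> dist x (last x p) <= size p.
Proof.
case/shortenP=> q e_q u_q sub_qp.
apply: (@leq_trans (size q)); last first.
  exact/uniq_leq_size/sub_qp/(subseq_uniq _ u_q)/subseq_cons.
by apply/dist_leq/existsP; exists (in_tuple q); rewrite e_q u_q eqxx.
Qed.

Lemma dist_refl x : dist x x = 0.
Proof. by apply/eqP; rewrite -leqn0; apply: (@dist_walk x [::]). Qed.

Lemma geodesic x y : connect (@adj G) x y ->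
  exists p, [/\ path (@adj G) x p, last x p = y & size p = dist x y].
Proof.
case/dist_has_path/existsP=> p /and3P[e_p /eqP l_p _].
by exists p; rewrite size_tuple.
Qed.

Lemma dist_adjacent x y z :
  connect (@adj G) x y -> adj y z -> dist x z <= (dist x y).+1.
Proof.
case/geodesic=> p [e_p l_p <-] yz.
have := @dist_walk x (rcons p z); rewrite rcons_path l_p e_p yz last_rcons size_rcons.
exact.
Qed.

Lemma dist_pred x y : connect (@adj G) x y -> y != x ->
  exists2 z, adj z y & dist x y = (dist x z).+1.
Proof.
move=> cxy; case: (geodesic cxy) => p [].
case/lastP: p => [_ /= ->|p z]; first by rewrite eqxx.
rewrite rcons_path last_rcons size_rcons => /andP[e_p adj_z] eq_zy sz_p _.
rewrite {z}eq_zy in adj_z; exists (last x p) => //.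
apply/eqP; rewrite eqn_leq dist_adjacent //=.
  by rewrite -sz_p ltnS dist_walk.
by apply/connectP; exists p.
Qed.

(** The predecessor condition makes f y the length of some walk from x,
whatever f may be; it gives connectedness as well as a bound on distance. *)
Lemma descent_walk x (f : G -> nat) : f x = 0 ->
  (forall y, y != x -> exists2 z, adj z y & f y = (f z).+1) ->
  forall y, exists p, [/\ path (@adj G) x p, last x p = y & size p = f y].
Proof.
move=> fx0 f_pred y; have [n] := ubnP (f y); elim: n y => // n IHn y.
have [-> _|/f_pred[z zy ->]] := eqVneq y x; first by exists [::].
rewrite ltnS => /IHn[p [e_p l_p s_p]].
by exists (rcons p y); rewrite rcons_path l_p e_p zy last_rcons size_rcons s_p.
Qed.

(** Distances in products and in paths are computed by checking two local
conditions: f grows by at most one along an edge, which bounds it by the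
length of any walk, and it can be decreased by a step towards x. *)
Lemma dist_unique x (f : G -> nat) : f x = 0 ->
  (forall y z, adj y z -> f z <= (f y).+1) ->
  (forall y, y != x -> exists2 z, adj z y & f y = (f z).+1) ->
  forall y, dist x y = f y.
Proof.
move=> fx0 f_adj f_pred y; apply/eqP; rewrite eqn_leq; apply/andP.
have [p [e_p l_p s_p]] := descent_walk fx0 f_pred y.
split; first by rewrite -s_p -l_p dist_walk.
have [|q [e_q <- <-]] := @geodesic x y; first by apply/connectP; exists p.
elim/last_ind: q e_q => [|q z IHq]; first by rewrite fx0.
rewrite rcons_path last_rcons size_rcons => /andP[/IHq le_q /f_adj].
by move/leq_trans; apply.
Qed.

Hypothesis connG : connected_graph G.

Lemma connected_connect x y : connect (@adj G) x y.
Proof. by case: connG. Qed.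
Hint Resolve connected_connect : core.

Lemma dist_sym x y : dist x y = dist y x.
Proof.
suff le_d (a b : G) : dist a b <= dist b a by apply/eqP; rewrite eqn_leq !le_d.
have [p [e_p l_p <-]] := geodesic (connected_connect b a).
have := @dist_walk (last b p) (rev (belast b p)).
rewrite rev_path size_rev size_belast l_p (eq_path (e' := @adj G)); last first.
  by move=> u v; rewrite adj_sym.
suff -> : last a (rev (belast b p)) = b by apply.
by case: p l_p {e_p} => [<-|u p _] //=; rewrite rev_cons last_rcons.
Qed.

Lemma dist_eq0 x y : (dist x y == 0) = (x == y).
Proof.
have [->|neq] := eqVneq x y; first by rewrite dist_refl.
by have [||z _ ->] := @dist_pred x y; rewrite // eq_sym.
Qed.

Lemma dist_eq1 x y : (dist x y == 1) = adj x y.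
Proof.
apply/eqP/idP => [d1|xy].
  have [||z zy] := @dist_pred x y => //.
    by rewrite eq_sym -dist_eq0 d1.
  by rewrite d1 => -[/esym/eqP]; rewrite dist_eq0 => /eqP->.
apply/eqP; rewrite eqn_leq lt0n dist_eq0.
have [eq_xy|_] := eqVneq x y; first by rewrite eq_xy adj_irrefl in xy.
by have := dist_adjacent (connect0 _ x) xy; rewrite dist_refl => ->.
Qed.

(** A walk from inside A to outside A has to cross the boundary of A. *)
Lemma boundary_edge (A : pred G) x y : A x -> ~~ A y ->
  exists u v, [/\ adj u v, A u & ~~ A v].
Proof.
move=> Ax nAy; have [p [e_p l_p _]] := geodesic (connected_connect x y).
elim: p x Ax e_p l_p => [|z p IHp] x Ax /= => [_ xy|/andP[xz e_p] l_p].
  by rewrite -xy Ax in nAy.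
by have [Az|nAz] := boolP (A z); [apply: IHp Az e_p l_p | exists x, z].
Qed.

End Distance.

Lemma dist_cart (G H : sgraph) : connected_graph G -> connected_graph H ->
  forall u v : cart_prod G H, dist u v = dist u.1 v.1 + dist u.2 v.2.
Proof.
move=> cG cH u; apply: dist_unique => [|y z|y]; first by rewrite !dist_refl.
  case/orP=> /andP[/eqP-> /dist_adjacent le_d];
    [rewrite -addnS leq_add2l | rewrite -addSn leq_add2r];
  by apply: le_d; apply: connected_connect.
case: y => a b /=; have [->|ne1 _] := eqVneq a u.1.
  have [->|ne2 _] := eqVneq b u.2; first by rewrite -surjective_pairing eqxx.
  have [z zb d_b] := dist_pred (connected_connect cH _ _) ne2.
  by exists (u.1, z); rewrite /= /cart_adj /= ?eqxx ?zb // d_b addnS.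
have [z za d_a] := dist_pred (connected_connect cG _ _) ne1.
by exists (z, b); rewrite /= /cart_adj /= ?eqxx ?za ?orbT // d_a addSn.
Qed.

(** On ordinals |i - j| is (i - j) + (j - i), one of the two truncated
differences being 0. *)
Lemma path_graph_pred n (i j : path_graph n) : j != i ->
  exists2 k : path_graph n, adj k j &
    (i - j) + (j - i) = ((i - k) + (k - i)).+1.
Proof.
rewrite -val_eqE neq_ltn /= => /orP[lt_ji|lt_ij].
  have lt_jn := leq_ltn_trans lt_ji (ltn_ord i).
  by exists (Ordinal lt_jn); rewrite /= ?/path_adj /=; lia.
have lt_jn : j.-1 < n by have := ltn_ord j; lia.
by exists (Ordinal lt_jn); rewrite /= ?/path_adj /=; lia.
Qed.

Lemma dist_path_graph n (i j : path_graph n) : dist i j = (i - j) + (j - i).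
Proof.
apply: (dist_unique (f := fun j : path_graph n => (i - j) + (j - i))).
- lia.
- by move=> k l; rewrite /= /path_adj; lia.
- exact: path_graph_pred.
Qed.

Lemma path_graph_connected n : connected_graph (path_graph n.+1).
Proof.
split=> [|i j]; first by rewrite card_ord.
have [||p [e_p l_p _]] :=
  @descent_walk _ i (fun j : path_graph n.+1 => (i - j) + (j - i)) _ _ j.
- lia.
- exact: path_graph_pred.
- by apply/connectP; exists p.
Qed.

(** * Rainbow progressions and the anti-van der Waerden number *)

(** Stated for any function d so that it applies to the metric of K_3 [] H
on pairs as well as to the distance of a graph. *)
Definition rainbow_free (V : Type) (C : eqType) (d : V -> V -> nat)
    (c : V -> C) :=
  forall u v w, d u v = d v w -> c u != c v -> c v != c w -> c u = c w.

Lemma no_rainbow_AP3 (G : sgraph) r (c : {ffun G -> 'I_r}) :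
  ~~ has_rainbow_AP 3 c -> rainbow_free (@dist G) c.
Proof.
move=> noR u v w d_uvw cuv cvw; apply/eqP; apply: contraNT noR => cuw.
apply/existsP; exists [ffun i : 'I_3 => nth u [:: u; v; w] i].
apply/andP; split.
  apply/is_APP; exists (dist u v) => -[[|[|[|i]]] lt_i] -[[|[|[|j]]] lt_j] //=;
  by move=> ij; try discriminate ij; rewrite !ffunE /= ?d_uvw.
apply/forallP=> -[[|[|[|i]]] lt_i] //; apply/forallP=> -[[|[|[|j]]] lt_j] //;
by rewrite !ffunE /= ?(eq_sym (c v)) ?(eq_sym (c w)) ?cuv ?cvw ?cuw ?implybT
  // eq_sym ?cvw.
Qed.

Lemma isometric_rainbow (A B : sgraph) k r (phi : A -> B)
    (c : {ffun B -> 'I_r}) :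
  (forall u v, dist (phi u) (phi v) = dist u v) ->
  has_rainbow_AP k [ffun u => c (phi u)] -> has_rainbow_AP k c.
Proof.
move=> iso /existsP[v /andP[/is_APP[d d_v] /forallP rb_v]].
apply/existsP; exists [ffun i => phi (v i)]; apply/andP; split.
  by apply/is_APP; exists d => i j ij; rewrite !ffunE iso d_v.
apply/forallP=> i; apply/forallP=> j.
by have := forallP (rb_v i) j; rewrite !ffunE.
Qed.

(** A rainbow k-AP takes k different colors out of r, and some exact coloring
with r colors exists once the graph has r vertices. *)
Lemma forces_leq (G : sgraph) k r :
  0 < r <= #|G| -> forces_rainbow_AP G k r -> k <= r.
Proof.
case/exact_coloring_ex=> c ex_c /forallP/(_ c).
rewrite ex_c => /existsP[v /andP[_ /forallP rb_v]].
rewrite -[k]card_ord -[r]card_ord; apply: (leq_card (fun i => c (v i))) => i j.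
by apply: contra_eq => ij; have := forallP (rb_v i) j; rewrite ij.
Qed.

Lemma aw_forces (G : sgraph) k : forces_rainbow_AP G k (aw G k).
Proof. by rewrite /aw; case: ex_minnP => r /andP[]. Qed.

Lemma aw_eq (G : sgraph) k :
  0 < k <= #|G| -> forces_rainbow_AP G k k -> aw G k = k.
Proof.
move=> /andP[k_gt0 le_kG] fk; rewrite /aw.
case: ex_minnP => r /andP[r_gt0 fr] r_min; apply/eqP; rewrite eqn_leq.
have le_rk : r <= k by apply: r_min; rewrite k_gt0.
by rewrite le_rk (forces_leq _ fr) // r_gt0 (leq_trans le_rk).
Qed.

(** * Coloring the product of a triangle and a connected graph *)

Lemma ord3_cover (a b e d : 'I_3) :
  a != b -> b != e -> a != e -> [|| d == a, d == b | d == e].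
Proof.
by case: a b e d => [[|[|[|a]]] la] [[|[|[|b]]] lb] [[|[|[|e]]] le] [[|[|[|d]]] ld].
Qed.

Lemma misses_or_onto (V : finType) (C : finType) (c : V -> C) :
  (exists a, forall u, c u != a) \/ (forall a, exists u, c u = a).
Proof.
have [/existsP[a /forallP na]|] := boolP [exists a, forall u, c u != a].
  by left; exists a.
rewrite negb_exists => /forallP on; right=> a.
by have := on a; rewrite negb_forall => /existsP[u]; rewrite negbK => /eqP; exists u.
Qed.

Lemma third_ord3 (a b : 'I_3) : a != b -> exists e, b != e /\ a != e.
Proof.
move=> ab; have /card_gt0P[e] : 0 < #|~: [set a; b]|.
  by have := cardsC [set a; b]; rewrite cards2 ab card_ord; lia.
by rewrite !inE negb_or !(eq_sym e) => /andP[ae be]; exists e.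
Qed.

Section TriangleProduct.
Variables (H : sgraph) (c : 'I_3 * H -> 'I_3).
Hypothesis connH : connected_graph H.

(** The distance of K_3 [] H, with K_3 on the vertex set 'I_3. *)
Let d (u v : 'I_3 * H) := (u.1 != v.1) + dist u.2 v.2.
Hypothesis c_free : rainbow_free d c.

(** The three vertices of a layer are pairwise at distance 1, hence cannot have
three different colors. *)
Lemma layer_two_colors i j l h : i != j -> j != l ->
  c (i, h) != c (j, h) -> c (j, h) != c (l, h) -> c (i, h) = c (l, h).
Proof. by move=> ij jl; apply: c_free; rewrite /d /= ij jl. Qed.

(** Two vertices of layer h lying off the row of (w, g) are equidistant from
it; so when the layer shows two colors, the third color is confined to the
row in which the layer departs from its majority. *)
Lemma third_color_row x y z h w g : x != y -> y != z -> x != z ->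
  c (y, h) = c (z, h) -> c (x, h) != c (y, h) ->
  c (w, g) != c (x, h) -> c (w, g) != c (y, h) -> w = x.
Proof.
move=> xy yz xz cyz cxy cwx cwy; apply/eqP; apply: contraNT cxy => wx.
have [wy|wy] := eqVneq w y; last first.
  apply/eqP; apply: (@c_free _ (w, g) _); rewrite // 1?eq_sym //.
  by rewrite /d /= (eq_sym x) wx wy (dist_sym connH).
(* Here w = y, so the two vertices of the layer off its row are x and z. *)
rewrite cyz; apply/eqP; apply: (@c_free _ (w, g) _); rewrite -?cyz // 1?eq_sym //.
by rewrite /d /= (eq_sym x) wx wy yz (dist_sym connH).
Qed.

(** The coloring comes from one of H. Distances from g to the ends of an edge
r b of H differ by at most one, and a change of row adds one to the shorter;
so if r, b and g had three colors, g would be the middle of a rainbow 3-AP. *)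
Lemma mono_layers_miss : (forall i j h, c (i, h) = c (j, h)) ->
  exists a, forall u, c u != a.
Proof.
move=> mono; case: (misses_or_onto c) => // onto.
have [[i0 h0] c0] := onto ord0; have [[i1 h1] c1] := onto ord_max.
have [||r [b [rb /eqP cr cb]]] :=
  @boundary_edge H connH (fun h => c (ord0, h) == ord0) h0 h1.
- by rewrite /= (mono _ i0) c0.
- by rewrite /= (mono _ i1) c1.
have c_rb : c (ord0, r) != c (ord0, b) by rewrite cr eq_sym.
have [e [be re]] := third_ord3 c_rb; have [[i g] cg] := onto e.
have {}cg : c (ord0, g) = e by rewrite (mono _ i).
have adj_d : dist g b <= (dist g r).+1 /\ dist g r <= (dist g b).+1.
  by split; apply: dist_adjacent; rewrite ?(connected_connect connH) // adj_sym.
suff [j [k jk]] : exists j k, d (j, r) (ord0, g) = d (ord0, g) (k, b).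
  case/eqP: c_rb; rewrite (mono _ j r) (mono _ k b); apply: c_free jk _ _.
    by rewrite (mono j ord0) cg.
  by rewrite (mono k ord0) cg eq_sym.
have [lt_rb|lt_br|eq_rb] := ltngtP (dist g r) (dist g b).
- by exists ord_max, ord0; rewrite /d /= (dist_sym connH r); lia.
- by exists ord0, ord_max; rewrite /d /= (dist_sym connH r); lia.
- by exists ord0, ord0; rewrite /d /= (dist_sym connH r); lia.
Qed.

(** Let e be the third color, found at (x, g) by third_color_row. Layer g has
two colors as well, so third_color_row applies to it in turn. This confines
both e and the color of (x, h) to row x, and row y is monochromatic. With k the
next to last vertex of a geodesic of H from g to h, (y, k) and (x, h) are
equidistant from (x, g): a rainbow 3-AP. *)
Lemma bichromatic_layer_miss x y z h : x != y -> y != z -> x != z ->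
  c (y, h) = c (z, h) -> c (x, h) != c (y, h) ->
  exists a, forall u, c u != a.
Proof.
move=> xy yz xz cyz cxy; case: (misses_or_onto c) => // onto.
have [e [cye cxe]] := third_ord3 cxy.
have [[w g] cwg] := onto e.
have wx : w = x.
  by apply: (third_color_row (g := g)) xy yz xz cyz cxy _ _; rewrite cwg eq_sym.
rewrite {w}wx in cwg.
have row k : k != x -> forall m, c (k, m) != e.
  move=> kx m; apply: contra kx => /eqP ckm; apply/eqP.
  by apply: (third_color_row (g := m)) xy yz xz cyz cxy _ _; rewrite ckm eq_sym.
have yx : y != x by rewrite eq_sym.
have zx : z != x by rewrite eq_sym.
have cyzg : c (y, g) = c (z, g).
  by apply: (@layer_two_colors y x z); rewrite ?cwg ?row // eq_sym row.
have cxyg : c (x, g) != c (y, g) by rewrite cwg eq_sym row.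
have cyg : c (y, g) = c (y, h).
  have /or3P[/eqP cb|/eqP//|] := ord3_cover (c (y, g)) cxy cye cxe; last first.
    by rewrite (negPf (row y yx g)).
  have eq_yx : y = x.
    apply: (third_color_row (g := h)) xy yz xz cyzg cxyg _ _; rewrite ?cwg ?cb //.
    by rewrite eq_sym.
  by rewrite eq_yx eqxx in yx.
have row_y m : c (y, m) = c (y, h).
  have /or3P[/eqP cb|/eqP//|] := ord3_cover (c (y, m)) cxy cye cxe; last first.
    by rewrite (negPf (row y yx m)).
  have eq_yx : y = x.
    by apply: (third_color_row (g := m)) xy yz xz cyzg cxyg _ _; rewrite ?cwg ?cyg ?cb.
  by rewrite eq_yx eqxx in yx.
have hg : h != g by apply: contraNneq cxe => ->; rewrite cwg.
have [k _ d_h] := dist_pred (connected_connect connH _ _) hg.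
have eq_c : c (y, k) = c (x, h).
  apply: (@c_free _ (x, g) _); rewrite ?row_y ?cwg //; last by rewrite eq_sym.
  by rewrite /d /= yx eqxx d_h (dist_sym connH k).
by rewrite -eq_c row_y eqxx in cxy.
Qed.

Lemma triangle_product_miss : exists a, forall u, c u != a.
Proof.
have [/forallP mono|] :=
  boolP [forall h, forall i, forall j, c (i, h) == c (j, h)].
  apply: mono_layers_miss => i j h; apply/eqP.
  by have /forallP/(_ i)/forallP := mono h; apply.
rewrite negb_forall => /existsP[h]; rewrite negb_forall => /existsP[i].
rewrite negb_forall => /existsP[j] cij.
have ij : i != j by apply: contraNneq cij => ->.
have [l [jl il]] := third_ord3 ij.
have [ji lj li] : [/\ j != i, l != j & l != i] by rewrite !(eq_sym l) (eq_sym j).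
have [cjl|cjl] := eqVneq (c (j, h)) (c (l, h)).
  exact: (@bichromatic_layer_miss i j l h).
by apply: (@bichromatic_layer_miss j i l h) => //;
  [apply: layer_two_colors cij cjl | rewrite eq_sym].
Qed.

End TriangleProduct.

(** * Coloring the product of a graph of diameter at most 2 *)

Section DiameterTwo.
Variables G H : sgraph.
Hypotheses (connG : connected_graph G) (connH : connected_graph H).
Hypothesis P3H : forces_rainbow_AP (cart_prod (path_graph 3) H) 3 3.
Variable c : {ffun cart_prod G H -> 'I_3}.
Hypothesis c_free : ~~ has_rainbow_AP 3 c.

(** X identifies 'I_3 with {x, y, z}; it is an isometry of K_3 into G if x and z
are adjacent, and of P_3 into G otherwise. *)
Lemma connected_triple_miss x y z : adj x y -> adj y z -> x != z ->
  exists a, forall w h, w \in [:: x; y; z] -> c (w, h) != a.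
Proof.
move=> xy yz xz; pose X (i : 'I_3) := nth x [:: x; y; z] i.
suff [a na] : exists a, forall u : 'I_3 * H, c (X u.1, u.2) != a.
  exists a => w h; rewrite !inE => /or3P[] /eqP->.
  - exact: (na (@Ordinal 3 0 isT, h)).
  - exact: (na (@Ordinal 3 1 isT, h)).
  - exact: (na (@Ordinal 3 2 isT, h)).
have /eqP dxy : dist x y == 1 by rewrite dist_eq1.
have /eqP dyz : dist y z == 1 by rewrite dist_eq1.
have dyx : dist y x = 1 by rewrite dist_sym.
have dzy : dist z y = 1 by rewrite dist_sym.
have [xz1|nxz1] := boolP (adj x z).
  have /eqP dxz : dist x z == 1 by rewrite dist_eq1.
  have dzx : dist z x = 1 by rewrite dist_sym.
  apply: triangle_product_miss => // u v w d_uvw.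
  have dX (s t : 'I_3 * H) :
      @dist (cart_prod G H) (X s.1, s.2) (X t.1, t.2) = (s.1 != t.1) + dist s.2 t.2.
    rewrite dist_cart //=; congr (_ + _).
    by case: s t => -[[|[|[|i]]] li] ? [[[|[|[|j]]] lj] ?] //=; rewrite /X /= ?dist_refl.
  by apply: (no_rainbow_AP3 c_free); rewrite !dX.
have dxz : dist x z = 2.
  have := dist_adjacent (connected_connect connG x y) yz; rewrite dxy.
  case E: (dist x z) => [|[|[|n]]] // _.
    by move/eqP: E; rewrite dist_eq0 // (negPf xz).
  by move/eqP: E; rewrite dist_eq1 // (negPf nxz1).
have dzx : dist z x = 2 by rewrite dist_sym.
pose phi (u : cart_prod (path_graph 3) H) : cart_prod G H := (X u.1, u.2).
have [//|onto] := misses_or_onto (fun u : 'I_3 * H => c (X u.1, u.2)).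
case/negP: c_free; apply: (@isometric_rainbow _ _ _ _ phi) => [u v|].
  rewrite !dist_cart //; last exact: path_graph_connected.
  rewrite dist_path_graph; congr (_ + _).
  by case: u v => -[[|[|[|i]]] li] ? [[[|[|[|j]]] lj] ?] //=; rewrite /X /= ?dist_refl.
apply: implyP (forallP P3H _) _; apply/forallP=> a; apply/existsP.
by have [u cu] := onto a; exists u; rewrite ffunE cu.
Qed.

Hypotheses (G_ge3 : 2 < #|G|) (diamG : diam G <= 2).

(** As x and z are not the only vertices, an edge leaves {x, z}; its far end is
the third vertex. *)
Lemma adjacent_in_triple (x z : G) : adj x z -> exists p q r,
  [/\ adj p q, adj q r, p != r & {subset [:: x; z] <= [:: p; q; r]}].
Proof.
move=> xz.
have [w nw] : exists w, ~~ (w \in [:: x; z]).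
  apply/existsP; rewrite -negb_forall; apply/negP=> /forallP all_xz.
  move: G_ge3; rewrite ltnNge (leq_trans _ (card_size [:: x; z])) //.
  by apply/subset_leq_card/subsetP.
have [|u [v [uv]]] := @boundary_edge G connG (mem [:: x; z]) x w _ nw.
  exact: mem_head.
rewrite !inE negb_or => /orP[] /eqP eu /andP[vx vz]; rewrite {u}eu in uv.
  exists z, x, v; rewrite adj_sym uv eq_sym vz; split=> // t.
  by rewrite !inE => /orP[] ->; rewrite ?orbT.
exists x, z, v; rewrite uv eq_sym vx xz; split=> // t.
by rewrite !inE => /orP[] ->; rewrite ?orbT.
Qed.

Lemma pair_in_triple (x z : G) : exists p q r,
  [/\ adj p q, adj q r, p != r & {subset [:: x; z] <= [:: p; q; r]}].
Proof.
have := leq_trans (dist_diam x z) diamG.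
case E: (dist x z) => [|[|[|n]]] // _.
- move/eqP: E; rewrite dist_eq0 // => /eqP <-.
  have [w nw] : exists w, w != x.
    apply/existsP; rewrite -negb_forall; apply/negP=> /forallP all_x.
    move: G_ge3; rewrite ltnNge ltnW // ltnS -(card1 x).
    by apply/subset_leq_card/subsetP=> w _; rewrite inE all_x.
  have [u [v [uv /eqP eu _]]] := boundary_edge connG (A := pred1 x) (eqxx x) nw.
  rewrite {u}eu in uv; have [p [q [r [pq qr pr sub]]]] := adjacent_in_triple uv.
  by exists p, q, r; split=> // t; rewrite mem_seq2 orbb => /eqP->; apply/sub/mem_head.
- by apply: adjacent_in_triple; rewrite -dist_eq1 ?E.
have ne_xz : x != z by rewrite -dist_eq0 ?E.
have [|y yz] := dist_pred (connected_connect connG x z); first by rewrite eq_sym.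
rewrite E => -[/esym/eqP]; rewrite dist_eq1 // => xy.
by exists x, y, z; split=> // t; rewrite !inE => /orP[] ->; rewrite ?orbT.
Qed.

Lemma two_rows_miss (x z : G) : exists a, forall h, c (x, h) != a /\ c (z, h) != a.
Proof.
have [p [q [r [pq qr pr sub]]]] := pair_in_triple x z.
have [a na] := connected_triple_miss pq qr pr.
by exists a => h; split; apply/na/sub; rewrite !inE eqxx ?orbT.
Qed.

Lemma cart_prod_miss : exists a, forall u, c u != a.
Proof.
have [//|onto] := misses_or_onto c.
have [row rowP] : exists row : 'I_3 -> G, forall a, exists h, c (row a, h) = a.
  have on a : exists u, c u == a by have [u <-] := onto a; exists u.
  exists (fun a => (xchoose (on a)).1) => a; exists (xchoose (on a)).2.
  by rewrite -surjective_pairing; apply/eqP/(xchooseP (on a)).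
(* If the row chosen for a had another color as well, it would show all three
   colors together with the row chosen for the remaining color e. *)
have mono a h : c (row a, h) = a.
  apply/eqP/negPn/negP=> nca.
  have [e [ae ce]] := third_ord3 nca.
  have [f nf] := two_rows_miss (row a) (row e).
  have /or3P[] := ord3_cover f nca ae ce.
  - by move/eqP=> ff; have [] := nf h; rewrite ff eqxx.
  - by move/eqP=> ff; have [k ck] := rowP a; have [] := nf k; rewrite ff ck eqxx.
  - by move/eqP=> ff; have [k ck] := rowP e; have [_] := nf k; rewrite ff ck eqxx.
have [h _] := rowP ord0.
have free a b e : a != b -> b != e -> a != e ->
    dist (row a) (row b) != dist (row b) (row e).
  move=> ab be ae; apply: contraNneq ae => d_abe; rewrite -(mono a h) -(mono e h).
  apply/eqP; apply: (@no_rainbow_AP3 _ _ _ c_free _ (row b, h) _); rewrite ?mono //.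
  by rewrite !dist_cart //= !dist_refl d_abe.
have d12 a b : a != b -> 0 < dist (row a) (row b) <= 2.
  move=> ab; rewrite (leq_trans (dist_diam _ _) diamG) andbT lt0n dist_eq0 //.
  by apply: contraNneq ab => eq_ab; rewrite -(mono a h) eq_ab mono.
pose o0 : 'I_3 := @Ordinal 3 0 isT; pose o1 : 'I_3 := @Ordinal 3 1 isT.
pose o2 : 'I_3 := @Ordinal 3 2 isT.
(* Three distances in {1, 2} cannot be pairwise different. *)
have := (free o0 o1 o2 isT isT isT, free o1 o2 o0 isT isT isT,
         free o2 o0 o1 isT isT isT).
have := (d12 o0 o1 isT, d12 o1 o2 isT, d12 o2 o0 isT).
by case=> -[] + + + [[]]; lia.
Qed.

End DiameterTwo.

Theorem theorem2p5 (G H : sgraph) :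
  connected_graph G -> 3 <= #|G| -> connected_graph H ->
  diam G <= 2 ->
  aw (cart_prod (path_graph 3) H) 3 = 3 ->
  aw (cart_prod G H) 3 = 3.
Proof.
move=> connG G_ge3 connH diamG awP3.
apply: aw_eq.
  by rewrite card_prod (leq_trans G_ge3) // leq_pmulr //; case: connH.
apply/forallP=> c; apply/implyP=> /forallP c_onto.
have [//|c_free] := boolP (has_rainbow_AP 3 c).
have P3H : forces_rainbow_AP (cart_prod (path_graph 3) H) 3 3.
  by have := aw_forces (cart_prod (path_graph 3) H) 3; rewrite awP3.
have [a na] := cart_prod_miss connG connH P3H c_free G_ge3 diamG.
by have /existsP[u] := c_onto a; rewrite (negPf (na u)).
Qed.
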